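(* Let $G$ be a graph with chromatic number $\chi(G) \geq 3$. Then $G$ contains $K_{1, 1, \chi(G) - 2}$ as an immersion.
   Context: All graphs are finite and loopless (parallel edges are allowed). $\chi(G)$ is the chromatic number of $G$. $K_{a,b,c}$ denotes the complete tripartite graph: the graph whose vertex set admits a partition into parts (independent sets) of sizes $a$, $b$ and $c$ such that any pair of these parts induces a complete bipartite graph. A graph $G$ contains an immersion of a graph $H$ (contains $H$ as an immersion) if there exist an injection $f \colon V(H) \to V(G)$ and a collection of pairwise edge-disjoint paths in $G$, one for each edge of $H$, such that the path corresponding to an edge joining $u$ and $v$ has endvertices $f(u)$ and $f(v)$. (Paths may pass through vertices in the image of $f$.) *)

(* Defs.v *)
From HB Require Import structures.
From mathcomp Require Import all_boot.

Set Implicit Arguments.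
Unset Strict Implicit.
Unset Printing Implicit Defensive.

(* Finite loopless multigraphs: having exactly two endvertices rules out loops,
   and [ends] need not be injective, so parallel edges are allowed. *)
Record mgraph := MGraph {
  vertex : finType;
  edge : finType;
  ends : edge -> {set vertex};
  card_ends : forall e, #|ends e| = 2
}.

Section Coloring.
Variable G : mgraph.

Definition proper_coloring k (c : {ffun vertex G -> 'I_k}) : bool :=
  [forall e : edge G, forall u : vertex G, forall v : vertex G,
    (ends e == [set u; v]) ==> (c u != c v)].

Definition colorable k : bool :=
  [exists c : {ffun vertex G -> 'I_k}, proper_coloring c].

Lemma ex_colorable : exists k, colorable k.
Proof.
exists #|vertex G|; apply/existsP; exists [ffun v => enum_rank v].
apply/forallP=> e; apply/forallP=> u; apply/forallP=> v; apply/implyP=> /eqP euv.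
rewrite !ffunE (inj_eq enum_rank_inj); apply/negP=> /eqP uv.
by have := card_ends e; rewrite euv uv setUid cards1.
Qed.

Definition chromatic_number : nat := ex_minn ex_colorable.

End Coloring.

Section Paths.
Variable G : mgraph.

(* A walk is given by its first vertex and the list of its successive steps
   (edge traversed, vertex reached). *)
Fixpoint is_walk (x : vertex G) (p : seq (edge G * vertex G)) : bool :=
  if p is (e, y) :: p' then (ends e == [set x; y]) && is_walk y p' else true.

Definition is_path_between (x y : vertex G) (p : seq (edge G * vertex G)) : bool :=
  [&& is_walk x p, uniq (x :: unzip2 p) & last x (unzip2 p) == y].

Definition edge_disjoint (p q : seq (edge G * vertex G)) : Prop :=
  forall e, ~ (e \in unzip1 p /\ e \in unzip1 q).

End Paths.

(* The path assigned to an edge may be listed starting from either end,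
   hence the existential choice of [u] and [v]. *)
Definition contains_immersion (G H : mgraph) : Prop :=
  exists (f : vertex H -> vertex G) (P : edge H -> seq (edge G * vertex G)),
    [/\ injective f,
        forall e : edge H, exists u v : vertex H,
          ends e = [set u; v] /\ is_path_between (f u) (f v) (P e)
      & forall e e' : edge H, e <> e' -> edge_disjoint (P e) (P e')].

Section CompleteTripartite.
Variables a b c : nat.

Definition tri_vertex : finType := ('I_a + 'I_b + 'I_c)%type.
Definition tri_edge : finType := ('I_a * 'I_b + 'I_a * 'I_c + 'I_b * 'I_c)%type.

Definition tri_ends (e : tri_edge) : {set tri_vertex} :=
  match e with
  | inl (inl (i, j)) => [set inl (inl i); inl (inr j)]
  | inl (inr (i, k)) => [set inl (inl i); inr k]
  | inr (j, k) => [set inl (inr j); inr k]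
  end.

Lemma card_tri_ends e : #|tri_ends e| = 2.
Proof. by case: e => [[[i j]|[i k]]|[j k]]; rewrite cards2. Qed.

Definition complete_tripartite : mgraph := MGraph card_tri_ends.

End CompleteTripartite.

(* Main.v *)
Require Import Defs.
From mathcomp Require Import all_boot perm.

Set Implicit Arguments.
Unset Strict Implicit.
Unset Printing Implicit Defensive.

(** Let [n + 2] be the chromatic number of [G], and colour the vertices with
    one colour too few, [n + 1], so that as few edges as possible have both
    ends of the same colour.  Some edge [xy] is monochromatic, of colour [a]
    say.  For every other colour [i] there is a path from [x] to [y] whose
    vertices are coloured alternately [a] and [i]: otherwise exchanging [a]
    and [i] on the Kempe component of [x] would repair [xy] without spoiling
    any other edge ([kempe_connected]).

    These [n] Kempe paths are edge-disjoint, since the colours at the ends of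
    an edge reveal which path it is on, and they avoid [xy].  The path of
    colour [i] leaves [x] towards a vertex [z_i] of colour [i]; these vertices
    are distinct from each other and from [x] and [y].  Cutting each path at
    [z_i] gives edge-disjoint paths from [x] to [z_i] and from [z_i] to [y],
    and [xy] itself joins the two remaining branch vertices: this is an
    immersion of the complete tripartite graph with parts 1, 1 and [n]. *)

Section Walks.
Variable G : mgraph.
Implicit Types (x y : vertex G) (q : seq (edge G * vertex G)).

Lemma ex_ends (e : edge G) : exists x y, x != y /\ ends e = [set x; y].
Proof.
by have /eqP/cards2P[x [y [xy E]]] := card_ends e; exists x, y; split.
Qed.

(** A vertex path records no edges; in a multigraph one must be chosen at each
    step, and [P] keeps track of the kind of edge that justified the step. *)
Lemma walk_of_path (P : pred (edge G)) x (p : seq (vertex G)) :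
    path (fun u v => [exists e, (ends e == [set u; v]) && P e]) x p ->
  exists q, [/\ is_walk x q, unzip2 q = p & all P (unzip1 q)].
Proof.
elim: p x => [|y p IHp] x /=; first by exists [::].
case/andP=> /existsP[e /andP[exy Pe]] /IHp[q [wq <- Pq]].
by exists ((e, y) :: q); rewrite /= exy wq Pe Pq.
Qed.

Lemma walk_avoids x y q e :
    is_walk y q -> x \notin y :: unzip2 q -> e \in unzip1 q ->
  x \notin ends e.
Proof.
elim: q y => //= -[d z] q IHq y /= /andP[/eqP dyz wq].
rewrite !inE !negb_or => /and3P[xy xz xq] /orP[/eqP->|eq].
  by rewrite dyz !inE negb_or xy.
by apply: IHq wq _ eq; rewrite inE negb_or xz.
Qed.

End Walks.

Section Conflicts.
Variables (G : mgraph) (k : nat).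
Implicit Types (c : {ffun vertex G -> 'I_k}) (e : edge G).

Definition conflicts c : {set edge G} := [set e | #|c @: ends e| == 1].

Lemma colors_ends c e x y :
  ends e = [set x; y] -> c @: ends e = [set c x; c y].
Proof. by move->; rewrite imsetU1 imset_set1. Qed.

Lemma in_conflicts c e x y :
  ends e = [set x; y] -> (e \in conflicts c) = (c x == c y).
Proof.
by move=> exy; rewrite inE (colors_ends c exy) cards2 eqSS eqb0 negbK.
Qed.

Lemma proper_conflicts c : conflicts c = set0 -> proper_coloring c.
Proof.
move=> c0; do 3!apply/forallP=> ?; apply/implyP=> /eqP euv.
by rewrite -(in_conflicts c euv) c0 inE.
Qed.

End Conflicts.

Section Kempe.
Variables (G : mgraph) (k : nat) (c : {ffun vertex G -> 'I_k}).
Implicit Types (e : edge G) (a i : 'I_k).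

Definition kempe_edge a i : pred (edge G) :=
  fun e => c @: ends e == [set a; i].

Definition kempe a i : rel (vertex G) :=
  fun u v => [exists e, (ends e == [set u; v]) && kempe_edge a i e].

Definition kempe_swap a i x : {ffun vertex G -> 'I_k} :=
  [ffun v => if connect (kempe a i) x v then tperm a i (c v) else c v].

(** An edge that leaves the swapped component is not an [a]-[i] edge, so if
    its end in the component changes colour, it does not take that of the
    other end; an edge inside the component has its colours permuted. *)
Lemma kempe_swap_neq a i x e u v : ends e = [set u; v] ->
  c u != c v -> kempe_swap a i x u != kempe_swap a i x v.
Proof.
have leaving e' w w' : ends e' = [set w; w'] -> c w != c w' ->
    connect (kempe a i) x w -> ~~ connect (kempe a i) x w' ->
  tperm a i (c w) != c w'.
  move=> eww' cww' xw; apply: contra => /eqP Eww'.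
  apply: connect_trans xw (connect1 _); apply/existsP; exists e'.
  rewrite eww' eqxx /kempe_edge (colors_ends c eww') /=; move: cww'.
  rewrite -Eww'; case: tpermP => [->|->|_ _]; rewrite ?eqxx //.
  by rewrite setUC eqxx.
move=> euv cuv; rewrite !ffunE.
case: ifPn => xu; case: ifPn => xv //.
- by rewrite (inj_eq perm_inj).
- exact: leaving euv cuv xu xv.
- by rewrite eq_sym; apply: (leaving e); rewrite 1?setUC 1?eq_sym.
Qed.

Lemma kempe_connected e x y i :
    (forall c' : {ffun vertex G -> 'I_k}, #|conflicts c| <= #|conflicts c'|) ->
    ends e = [set x; y] -> c x = c y -> i != c x ->
  connect (kempe (c x) i) x y.
Proof.
move=> c_min exy cxy ix; apply: contraT => nxy.
have := c_min (kempe_swap (c x) i x); rewrite leqNgt => /negP[].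
apply: proper_card; apply/properP; split; last exists e.
- apply/subsetP=> d; have [u [v [_ duv]]] := ex_ends d.
  rewrite !(in_conflicts _ duv); apply: contraLR; exact: kempe_swap_neq duv.
- by rewrite (in_conflicts _ exy) cxy.
- by rewrite (in_conflicts _ exy) !ffunE connect0 (negPf nxy) tpermL -cxy.
Qed.

(** The form in which the paths are used: the first step is split off, as its
    endvertex is to be a branch vertex. *)
Lemma kempe_path x y i :
    x != y -> i != c x -> connect (kempe (c x) i) x y ->
  exists t : edge G * vertex G * seq (edge G * vertex G),
    [/\ is_path_between x y (t.1 :: t.2),
        all (kempe_edge (c x) i) (unzip1 (t.1 :: t.2))
      & c t.1.2 = i].
Proof.
move=> xy ix /connectP[p0 /shortenP[p pp up _] Ey].
have [q [wq Eq aq]] := walk_of_path pp.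
case: q wq Eq aq => [_ Ep|[e z] q wq Ep aq].
  by rewrite -Ep /= in Ey; rewrite Ey eqxx in xy.
exists (e, z, q); split=> //.
  by apply/and3P; split; rewrite ?Ep // Ey.
have /andP[/eqP exz _] := wq; have /andP[/eqP + _] := aq.
rewrite (colors_ends c exz) => /setP/(_ i).
by rewrite !inE eqxx orbT (negPf ix) => /eqP.
Qed.

End Kempe.

(** Of the [n + 1] colours, [n] differ from that of a given monochromatic
    edge [xy]: they are the [lift (c x) j] with [j : 'I_n], so that the Kempe
    paths are indexed by the part of size [n]. *)
Lemma immersion_of_uncolorable (G : mgraph) n :
  ~~ colorable G n.+1 -> contains_immersion G (complete_tripartite 1 1 n).
Proof.
move=> ncol.
case: (@arg_minnP _ [ffun=> ord0] xpredT
  (fun c : {ffun vertex G -> 'I_n.+1} => #|conflicts c|) isT) => c _ c_min.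
have [e0 e0c] : exists e, e \in conflicts c.
  apply/set0Pn; apply: contra ncol => /eqP c0.
  by apply/existsP; exists c; apply: proper_conflicts.
have [x [y [xy e0xy]]] := ex_ends e0.
have /eqP cxy : c x == c y by rewrite -(in_conflicts c e0xy).
have lift_neq j : lift (c x) j != c x by rewrite eq_sym neq_lift.
have /fin_all_exists[t tP] : forall j : 'I_n, exists t : edge G * vertex G * _,
    [/\ is_path_between x y (t.1 :: t.2),
        all (kempe_edge c (c x) (lift (c x) j)) (unzip1 (t.1 :: t.2))
      & c t.1.2 = lift (c x) j].
  move=> j; apply: kempe_path => //.
  by apply: kempe_connected e0xy cxy _ => // c'; apply: c_min.
pose z j := (t j).1.2.
have cz j : c (z j) = lift (c x) j by case: (tP j).
have z_x j : z j != x by apply: contraNneq (lift_neq j) => zx; rewrite -cz zx.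
have z_y j : z j != y.
  by apply: contraNneq (lift_neq j) => zy; rewrite -cz zy cxy.
have z_inj : injective z.
  by move=> j j' E; apply: (@lift_inj _ (c x)); rewrite -!cz E.
have on_path j e : e \in unzip1 ((t j).1 :: (t j).2) ->
    c @: ends e = [set c x; lift (c x) j].
  by case: (tP j) => _ /allP aj _ /aj/eqP.
have same_path j j' e : e \in unzip1 ((t j).1 :: (t j).2) ->
    e \in unzip1 ((t j').1 :: (t j').2) -> j = j'.
  move=> /on_path Ej /on_path; rewrite Ej => /setP/(_ (lift (c x) j)).
  rewrite !inE eqxx orbT (negPf (lift_neq j)) => /esym/eqP; exact: lift_inj.
have off_path j : e0 \notin unzip1 ((t j).1 :: (t j).2).
  apply/negP=> /on_path E; move: e0c.
  by rewrite inE E cards2 neq_lift.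
have first_edge j : ends (t j).1.1 = [set x; z j].
  by have [/and3P[/=]] := tP j; rewrite /z; case: (t j).1 => e w /andP[/eqP].
have [walk_tail uniq_tail last_tail] : [/\ forall j, is_walk (z j) (t j).2,
    forall j, uniq (x :: z j :: unzip2 (t j).2)
  & forall j, last (z j) (unzip2 (t j).2) == y].
  by split=> j; have [/and3P[/=]] := tP j;
    rewrite /z; case: (t j).1 => e w /andP[].
have first_off_tail j : (t j).1.1 \notin unzip1 (t j).2.
  apply/negP=> et; have /andP[nx _] := uniq_tail j.
  by have := walk_avoids (walk_tail j) nx et; rewrite first_edge !inE eqxx.
have mem_first j : (t j).1.1 \in unzip1 ((t j).1 :: (t j).2).
  by rewrite inE eqxx.
have mem_tail j e : e \in unzip1 (t j).2 ->
    e \in unzip1 ((t j).1 :: (t j).2) by rewrite inE => ->; rewrite orbT.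
exists (fun v : tri_vertex 1 1 n =>
          match v with inl (inl _) => x | inl (inr _) => y | inr j => z j end).
exists (fun d : tri_edge 1 1 n =>
          match d with
          | inl (inl _) => [:: (e0, y)]
          | inl (inr (_, j)) => [:: (t j).1]
          | inr (_, j) => (t j).2
          end).
split.
- move=> [[u|u]|j] [[v|v]|j']; rewrite ?(ord1 u) ?(ord1 v) // => /eqP.
  + by rewrite (negPf xy).
  + by rewrite eq_sym (negPf (z_x j')).
  + by rewrite eq_sym (negPf xy).
  + by rewrite eq_sym (negPf (z_y j')).
  + by rewrite (negPf (z_x j)).
  + by rewrite (negPf (z_y j)).
  + by move=> /eqP/z_inj->.
- move=> [[[u v]|[u j]]|[v j]].
  + exists (inl (inl u)), (inl (inr v)); split=> //.
    by rewrite /is_path_between /= e0xy !inE !eqxx xy.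
  + exists (inl (inl u)), (inr j); split=> //.
    rewrite /is_path_between /=; move: (first_edge j) (z_x j); rewrite /z.
    by case: (t j).1 => e w /= -> zx; rewrite !inE !eqxx eq_sym zx.
  +
    (* The tail of the Kempe path runs towards [y], so it is listed from the
       vertex of the large part. *)
    exists (inr j), (inl (inr v)); split; first exact: setUC.
    by apply/and3P; split=> //; have /andP[] := uniq_tail j.
- move=> [[[u v]|[u j]]|[v j]] [[[u' v']|[u' j']]|[v' j']] + e [] /=;
    rewrite ?mem_seq1 ?(ord1 u) ?(ord1 v) ?(ord1 u') ?(ord1 v') //.
  + by move=> _ /eqP-> /eqP E; have := off_path j'; rewrite E mem_first.
  + by move=> _ /eqP-> /mem_tail E; have := off_path j'; rewrite E.
  + by move=> _ /eqP-> /eqP E; have := off_path j; rewrite -E mem_first.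
  + move=> ne /eqP-> /eqP E; apply: ne; congr (inl (inr (_, _))).
    by apply: same_path (mem_first j) _; rewrite E mem_first.
  + move=> _ /eqP-> E; have Ej := same_path _ _ _ (mem_first j) (mem_tail _ _ E).
    by have := first_off_tail j; rewrite {2}Ej E.
  + by move=> _ /mem_tail E /eqP e_e0; have := off_path j; rewrite -e_e0 E.
  + move=> _ E /eqP Ee; rewrite Ee in E.
    have Ej := same_path _ _ _ (mem_first j') (mem_tail _ _ E).
    by have := first_off_tail j'; rewrite {2}Ej E.
  + move=> ne /mem_tail E /mem_tail E'; apply: ne; congr (inr (_, _)).
    exact: same_path E E'.
Qed.

Theorem proposition6 (G : mgraph) (hchi : 3 <= chromatic_number G) :
  contains_immersion G (complete_tripartite 1 1 (chromatic_number G - 2)).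
Proof.
apply: immersion_of_uncolorable; move: hchi; rewrite /chromatic_number.
case: ex_minnP => k _ k_min k3; apply/negP=> /k_min.
by case: k k3 {k_min} => [|[|k]] // _; rewrite subSS subSS subn0 ltnn.
Qed.
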